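(* Let $\mathcal{H}$ be a real Hilbert space, let $f: \mathcal{H} \to \mathcal{H}$ be defined everywhere, and let $L>0$. The following are equivalent: (1) there is $\varphi: \mathcal{H} \to \mathbb{R} \cup \{+\infty\}$ such that $f(y) \in \mathrm{prox}_{\varphi}(y)$ for all $y\in\mathcal{H}$, and $x \mapsto \varphi(x)+\left(1-\tfrac{1}{L}\right)\tfrac{\|x\|^{2}}{2}$ is convex lower semicontinuous; (2) the following conditions hold jointly: (a) there exists a (convex lower semicontinuous) function $\psi:\mathcal{H}\to\mathbb{R}\cup\{+\infty\}$ such that for each $y \in \mathcal{H}$, $f(y) \in \partial \psi(y)$; (b) $f$ is $L$-Lipschitz, i.e. $\|f(y)-f(y')\| \leq L \|y-y'\|$ for all $y,y' \in \mathcal{H}$.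
   Context: For $\varphi: \mathcal{H} \to \mathbb{R}\cup\{+\infty\}$, $\mathrm{prox}_\varphi(y) := \arg\min_{x \in \mathcal{H}} \{\tfrac12\|y-x\|^2 + \varphi(x)\}$ is the set of global minimizers (a minimizer is required to have finite objective value, so the set is empty if $\varphi\equiv+\infty$). For $\theta:\mathcal{H}\to\mathbb{R}\cup\{+\infty\}$, $\partial\theta(x)$ is the set of $u\in\mathcal{H}$ with $\theta(x')\geq\theta(x)+\langle u,x'-x\rangle$ for all $x'\in\mathcal{H}$ when $\theta(x)<+\infty$, and $\partial\theta(x)=\varnothing$ when $\theta(x)=+\infty$. *)

(* Defs.v *)
From HB Require Import structures.
From mathcomp Require Export all_boot all_order all_algebra.
From mathcomp Require Export sesquilinear.
From mathcomp Require Export boolp classical_sets functions reals ereal.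
From mathcomp Require Export topology normedtype.

Set Implicit Arguments.
Unset Strict Implicit.
Unset Printing Implicit Defensive.

Import Order.TTheory GRing.Theory Num.Theory.
Import numFieldNormedType.Exports.

Local Open Scope classical_set_scope.
Local Open Scope ring_scope.

(* A function H -> R \cup {+oo} is a function H -> \bar R that never takes
   the value -oo. *)
Definition never_ninfty (R : realType) (H : Type) (phi : H -> \bar R) : Prop :=
  forall x, phi x != -oo%E.

(* With t in the open interval there is no product 0 * +oo, and for functions
   satisfying never_ninfty there is no sum of opposite infinities. *)
Definition econvex (R : realType) (H : lmodType R) (g : H -> \bar R) : Prop :=
  forall (x y : H) (t : R), 0 < t -> t < 1 ->
    (g (t *: x + (1 - t) *: y)%R <= t%:E * g x + (1 - t)%:E * g y)%E.

Section prox_subdifferential.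
Variables (R : realType) (H : normedModType R).

Definition prox_objective (phi : H -> \bar R) (y x : H) : \bar R :=
  ((2^-1 * `|y - x| ^+ 2)%:E + phi x)%E.

Definition prox (phi : H -> \bar R) (y : H) : set H :=
  [set x | prox_objective phi y x \is a fin_num /\
           forall z, (prox_objective phi y x <= prox_objective phi y z)%E].

Definition subdifferential (dot : {dot H for (@idfun R)})
    (theta : H -> \bar R) (x : H) : set H :=
  [set u | (theta x < +oo)%E /\
           forall x', (theta x + (dot u (x' - x))%:E <= theta x')%E].

End prox_subdifferential.

(* Main.v *)
(** Up to the term [|y|^2 / 2], the proximal objective is [h x - <y, x>] with
    [h = phi + |.|^2 / 2], so [f y] is a maximizer in the Fenchel conjugate
    [psi] of [h].  If [phi + (1 - 1/L) |.|^2 / 2] is convex, then [h] is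
    [1/L]-strongly convex; adding the quadratic growth inequalities at [f y] and
    [f z] gives [|f y - f z|^2 <= L <y - z, f y - f z>].  Conversely, if the
    subgradient selection [f] of [psi] is [L]-Lipschitz, then
    [psi z >= psi y + <f y, z - y> + |f z - f y|^2 / (2 L)].  This says that
    [G x = sup_y (<y - f y / L, x> + |f y|^2 / (2 L) - psi y)], a supremum of
    affine functions, is attained at the index [y] when [x = f y], and
    [phi = G - (1 - 1/L) |.|^2 / 2] works. *)
Require Import Defs.
From mathcomp Require Import ring lra.
Set Implicit Arguments.
Unset Strict Implicit.
Unset Printing Implicit Defensive.

Import Order.TTheory GRing.Theory Num.Theory.
Import numFieldNormedType.Exports.
Local Open Scope classical_set_scope.
Local Open Scope ring_scope.

(** * Inner product identities *)

Section inner_product.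
Variables (R : realType) (H : normedModType R) (dot : {dot H for (@idfun R)}).
Hypothesis dotE : forall x : H, `|x| ^+ 2 = dot x x.

Lemma dotC (x y : H) : dot x y = dot y x.
Proof. by rewrite hermC expr0 mul1r. Qed.

Lemma dotDl (x y z : H) : dot (x + y) z = dot x z + dot y z.
Proof. exact: linearDl. Qed.

Lemma dotDr (x y z : H) : dot x (y + z) = dot x y + dot x z.
Proof. exact: linearDr. Qed.

Lemma dotNl (x y : H) : dot (- x) y = - dot x y.
Proof. exact: linearNl. Qed.

Lemma dotNr (x y : H) : dot x (- y) = - dot x y.
Proof. exact: linearNr. Qed.

Lemma dotZl (a : R) (x y : H) : dot (a *: x) y = a * dot x y.
Proof. exact: linearZl_LR. Qed.

Lemma dotZr (a : R) (x y : H) : dot x (a *: y) = a * dot x y.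
Proof. exact: linearZr_LR. Qed.

Definition dot_linear := (dotDl, dotDr, dotNl, dotNr, dotZl, dotZr).

Lemma sqr_normD (x y : H) :
  `|x + y| ^+ 2 = `|x| ^+ 2 + 2 * dot x y + `|y| ^+ 2.
Proof. by rewrite !dotE !dot_linear (dotC y x); ring. Qed.

Lemma sqr_normB (x y : H) :
  `|x - y| ^+ 2 = `|x| ^+ 2 - 2 * dot x y + `|y| ^+ 2.
Proof. by rewrite sqr_normD dotNr normrN; ring. Qed.

Lemma sqr_norm_convex (t : R) (x y : H) :
  `|t *: x + (1 - t) *: y| ^+ 2 =
    t * `|x| ^+ 2 + (1 - t) * `|y| ^+ 2 - t * (1 - t) * `|x - y| ^+ 2.
Proof. by rewrite !dotE !dot_linear (dotC y x); ring. Qed.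

(** Cauchy-Schwarz, read off from the squared triangle inequality. *)
Lemma dot_le_norm (x y : H) : dot x y <= `|x| * `|y|.
Proof.
have : `|x + y| ^+ 2 <= (`|x| + `|y|) ^+ 2.
  by rewrite lerXn2r ?nnegrE ?addr_ge0// ler_normD.
by rewrite sqr_normD sqrrD -mulr_natl; lra.
Qed.

Lemma continuous_dot (u : H) : continuous (dot u).
Proof.
have -> : (dot u : H -> R) =
    (fun x => (`|u + x| ^+ 2 - `|u| ^+ 2 - `|x| ^+ 2) / 2).
  by apply/funext => x; rewrite sqr_normD; field.
move=> x; apply: cvgMr_tmp; apply: cvgB; last first.
  by rewrite expr2; apply: cvgM; apply: cvg_norm; exact: cvg_id.
apply: cvgB; last exact: cvg_cst.
by rewrite expr2; apply: cvgM; apply: cvg_norm; apply: cvgD;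
  [exact: cvg_cst|exact: cvg_id|exact: cvg_cst|exact: cvg_id].
Qed.

(** * Suprema of affine functions *)

Section affine_sup.
Variables (I : Type) (u : I -> H) (c : I -> R).

Definition affine_sup (x : H) : \bar R :=
  ereal_sup [set (dot (u i) x + c i)%:E | i in [set: I]].

Lemma affine_sup_ge (i : I) (x : H) : ((dot (u i) x + c i)%:E <= affine_sup x)%E.
Proof. by apply: ereal_sup_ubound; exists i. Qed.

Lemma affine_sup_attained (i : I) (x : H) :
  (forall j, dot (u j) x + c j <= dot (u i) x + c i) ->
  affine_sup x = (dot (u i) x + c i)%:E.
Proof.
move=> ub; apply/eqP; rewrite eq_le affine_sup_ge andbT.
by apply: ge_ereal_sup => _ [j _ <-]; rewrite lee_fin.
Qed.

(** The index [i] rules out the empty family, whose supremum is -oo. *)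
Lemma affine_sup_never_ninfty (i : I) : never_ninfty affine_sup.
Proof.
move=> x; have := affine_sup_ge i x.
by case: (affine_sup x).
Qed.

Lemma econvex_affine_sup : econvex affine_sup.
Proof.
move=> x y t t0 t1; apply: ge_ereal_sup => _ [i _ <-].
have -> : (dot (u i) (t *: x + (1 - t) *: y) + c i)%:E =
    (t%:E * (dot (u i) x + c i)%:E + (1 - t)%:E * (dot (u i) y + c i)%:E)%E.
  by rewrite -!EFinM -EFinD !dot_linear; congr EFin; ring.
by apply: leeD; apply: lee_wpmul2l; rewrite ?affine_sup_ge// lee_fin;
  rewrite ?subr_ge0 ltW.
Qed.

Lemma lower_semicontinuous_affine_sup : lower_semicontinuous affine_sup.
Proof.
move=> x a /ereal_sup_gt[_ [i _ <-]]; rewrite lte_fin => ai.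
exists [set y | a < dot (u i) y + c i]; last first.
  by move=> y /= ay; apply: lt_le_trans (affine_sup_ge i y); rewrite lte_fin.
have cont : (fun y => dot (u i) y + c i) @ x --> dot (u i) x + c i.
  by apply: cvgD; [exact: continuous_dot|exact: cvg_cst].
exact: (cvgr_gt _ cont).
Qed.

End affine_sup.

(** * Convex functions with a Lipschitz subgradient selection *)

Section smooth_convex.
Variables (p : H -> R) (f : H -> H) (L : R).
Hypothesis L_gt0 : 0 < L.
Hypothesis subgrad : forall y z, p y + dot (f y) (z - y) <= p z.
Hypothesis f_lip : forall y z, `|f y - f z| <= L * `|y - z|.

(* Adding up the subgradient inequalities along a subdivision of a segment
   replaces the integration of the gradient: the quadratic term k (k + 1) / 2
   is a Riemann sum. *)
Lemma descent_subdivision (y d : H) (k : nat) :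
  p (y + d *+ k) <=
    p y + k%:R * dot (f y) d + L * `|d| ^+ 2 * (k%:R * (k%:R + 1) / 2).
Proof.
elim: k => [|k IH]; first by rewrite addr0 !mul0r mulr0 !addr0.
set z := y + d *+ k.+1.
(* Taken at the right endpoint [z], the subgradient inequality bounds [p z] from above. *)
have := subgrad z (y + d *+ k).
have -> : y + d *+ k - z = - d.
  by rewrite /z mulrSr addrA opprD addrA subrr sub0r.
rewrite dotNr => step.
have : dot (f z - f y) d <= L * (k.+1%:R * `|d|) * `|d|.
  apply: le_trans (dot_le_norm _ _) _; apply: ler_wpM2r => //.
  apply: le_trans (f_lip _ _) _.
  by rewrite /z [y + _]addrC addrK normrMn mulr_natl.
rewrite dotDl dotNl -natr1 => lip.
by move: step IH lip; rewrite expr2; lra.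
Qed.

Lemma descent (y z : H) :
  p z <= p y + dot (f y) (z - y) + L / 2 * `|z - y| ^+ 2.
Proof.
set C := L / 2 * `|z - y| ^+ 2.
have C_ge0 : 0 <= C by rewrite mulr_ge0 ?sqr_ge0// divr_ge0 ?ltW.
apply/ler_addgt0Pr => e e_gt0.
(* With [n.+1] pieces the Riemann sum exceeds its limit [C] by [C / n.+1], which this choice keeps
   below [e]. *)
set n := Num.truncn (C / e).
have n_gt : C < n.+1%:R * e by rewrite -ltr_pdivrMr//; exact: truncnS_gt.
have n_gt0 : 0 < n.+1%:R :> R by rewrite ltr0n.
have := descent_subdivision y (n.+1%:R^-1 *: (z - y)) n.+1.
rewrite -scaler_nat scalerA divff ?gt_eqF// scale1r [y + _]addrC subrK.
rewrite dotZr mulrA divff ?gt_eqF// mul1r normrZ gtr0_norm ?invr_gt0//.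
have -> : L * (n.+1%:R^-1 * `|z - y|) ^+ 2 * (n.+1%:R * (n.+1%:R + 1) / 2) =
    C + C / n.+1%:R by rewrite /C; field; rewrite gt_eqF.
have : C / n.+1%:R <= e by rewrite ler_pdivrMr// mulrC ltW.
by move=> Cn /le_trans; apply; rewrite addrA lerD2l.
Qed.

(* Compare the subgradient inequality at [y] and the descent inequality at [z]
   at the point [z - L^-1 (f z - f y)]. *)
Lemma subgrad_cocoercive (y z : H) :
  p y + dot (f y) (z - y) + `|f z - f y| ^+ 2 / (2 * L) <= p z.
Proof.
(* [w] minimizes the quadratic upper bound that [descent] at [z] gives for [p] minus [dot (f y)]. *)
set w := z - L^-1 *: (f z - f y).
have lb := subgrad y w; have := le_trans lb (descent z w).
have wz : w - z = - (L^-1 *: (f z - f y)) by rewrite /w addrC addKr.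
have -> : w - y = (z - y) - L^-1 *: (f z - f y) by rewrite /w addrAC.
rewrite wz normrN normrZ gtr0_norm ?invr_gt0//.
rewrite dotDr !dotNr !dotZr => main.
have : L^-1 * `|f z - f y| ^+ 2 = L^-1 * (dot (f z) (f z - f y) -
    dot (f y) (f z - f y)).
  by rewrite dotE [X in _ = _ * X](_ : _ = dot (f z - f y) (f z - f y))
    // dotDl dotNl.
have E1 : L / 2 * (L^-1 * `|f z - f y|) ^+ 2 = L^-1 * `|f z - f y| ^+ 2 / 2.
  by field; rewrite gt_eqF.
have -> : `|f z - f y| ^+ 2 / (2 * L) = L^-1 * `|f z - f y| ^+ 2 / 2.
  by field; rewrite gt_eqF.
by move: main; rewrite E1; lra.
Qed.

End smooth_convex.

(** The objective is a convex function plus [(1 - a) / 2] times the squared norm. Minimality is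
    tested at a point of the segment from [x] to [x'], close to [x]. *)
Lemma prox_quadratic_growth (phi : H -> \bar R) (a q q' : R) (y x x' : H) :
  prox phi y x ->
  econvex (fun z => phi z + (a * (`|z| ^+ 2 / 2))%:E)%E ->
  phi x = q%:E -> phi x' = q'%:E ->
  2^-1 * `|y - x| ^+ 2 + q + (1 - a) / 2 * `|x' - x| ^+ 2 <=
    2^-1 * `|y - x'| ^+ 2 + q'.
Proof.
move=> [_ xmin] conv phix phix'; set E := (1 - a) / 2 * _.
apply/ler_addgt0Pr => e e_gt0.
have D_gt0 : 0 < e + `|E| + 1 by rewrite ltr_pwDr// addr_ge0// ltW.
(* Instead of letting [t] tend to 0, fix [t] in (0, 1) with [t * E <= e]. *)
set t := e / (e + `|E| + 1).
have t_gt0 : 0 < t by rewrite divr_gt0.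
have t_lt1 : t < 1.
  by rewrite ltr_pdivrMr// mul1r -addrA ltrDl ltr_pwDr.
have tE : t * E <= e.
  rewrite mulrAC ler_pdivrMr// ler_pM2l//.
  by rewrite (le_trans (ler_norm _))// -addrA addrCA lerDl addr_ge0// ltW.
have := xmin (t *: x' + (1 - t) *: x).
have := conv x' x t t_gt0 t_lt1.
(* Convexity excludes the value +oo here, and minimality excludes -oo. *)
rewrite /prox_objective phix phix'; case: (phi _) => [r| |]//=.
rewrite !lee_fin.
have -> : y - (t *: x' + (1 - t) *: x) = t *: (y - x') + (1 - t) *: (y - x).
  by rewrite !scalerBr addrACA -scalerDl [t + _]addrC subrK scale1r -opprD.
rewrite !sqr_norm_convex.
have -> : y - x' - (y - x) = - (x' - x).
  by rewrite !opprB addrC addrA subrK.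
rewrite normrN => conv_t min_t.
have : t * (2^-1 * `|y - x| ^+ 2 + q + E) <=
    t * (2^-1 * `|y - x'| ^+ 2 + q' + t * E).
  rewrite /E; move: conv_t min_t.
  by set X := `|x' - x| ^+ 2; set Y := `|y - x| ^+ 2; lra.
by rewrite ler_pM2l//; lra.
Qed.

End inner_product.

Theorem proposition2 (R : realType) (H : completeNormedModType R)
    (dot : {dot H for (@idfun R)})
    (dotE : forall x : H, `|x| ^+ 2 = dot x x)
    (f : H -> H) (L : R) (L_gt0 : 0 < L) :
  (exists phi : H -> \bar R,
    [/\ never_ninfty phi,
        forall y, prox phi y (f y),
        econvex (fun x => phi x + ((1 - L^-1) * (`|x| ^+ 2 / 2))%:E)%E &
        lower_semicontinuous
          (fun x => phi x + ((1 - L^-1) * (`|x| ^+ 2 / 2))%:E)%E])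
  <->
  ((exists psi : H -> \bar R,
    [/\ never_ninfty psi,
        econvex psi,
        lower_semicontinuous psi &
        forall y, subdifferential dot psi y (f y)])
   /\ L.-lipschitz f).
Proof.
have Linv_gt0 : 0 < L^-1 by rewrite invr_gt0.
split=> [[phi [_ phi_prox phi_conv _]]|[[psi [psi_ninfty _ _ psi_sub]] f_lip]].
  pose q y := fine (phi (f y)).
  have phiE y : phi (f y) = (q y)%:E.
    rewrite /q fineK//; have [+ _] := phi_prox y.
    by rewrite /prox_objective; case: (phi _).
  have growth y z := prox_quadratic_growth dotE (phi_prox y) phi_conv
    (phiE y) (phiE z).
  (* [c y] is [- h (f y)], so [affine_sup dot f c] is the conjugate of [h] with the supremum
     restricted to the range of [f]. *)
  pose c y := - (q y + `|f y| ^+ 2 / 2).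
  have psiE y : affine_sup dot f c y = (dot (f y) y + c y)%:E.
    apply: affine_sup_attained => z; rewrite /c.
    have := growth y z; rewrite !(sqr_normB dotE y) !(dotC dot y).
    have : 0 <= L^-1 * `|f z - f y| ^+ 2 by rewrite mulr_ge0 ?sqr_ge0// ltW.
    by lra.
  split; [exists (affine_sup dot f c); split|].
  - exact: affine_sup_never_ninfty 0.
  - exact: econvex_affine_sup.
  - exact: lower_semicontinuous_affine_sup.
  - move=> y; split=> [|z]; rewrite psiE ?ltry//.
    apply: le_trans (affine_sup_ge dot f c y z).
    by rewrite -EFinD lee_fin dotDr dotNr; lra.
  - move=> [y z] _ /=.
    have [->|fyz] := eqVneq (f y) (f z).
      by rewrite subrr normr0 mulr_ge0// ltW.
    have n_gt0 : 0 < `|f y - f z| by rewrite normr_gt0 subr_eq0.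
    rewrite -(ler_pM2r n_gt0) -expr2 -mulrA -ler_pdivrMl//.
    apply: le_trans (dot_le_norm dotE _ _).
    have := growth y z; have := growth z y.
    rewrite (distrC (f z)) !(sqr_normB dotE y) !(sqr_normB dotE z).
    by rewrite !dot_linear; lra.
(* A subgradient exists at every point, so [psi] is finite everywhere. *)
pose p y := fine (psi y).
have psiE y : psi y = (p y)%:E.
  rewrite /p fineK//; have [+ _] := psi_sub y; have := psi_ninfty y.
  by case: (psi y).
have subgrad y z : p y + dot (f y) (z - y) <= p z.
  have [_ /(_ z)] := psi_sub y.
  by rewrite !psiE -EFinD lee_fin.
have lip y z : `|f y - f z| <= L * `|y - z| by exact: (f_lip (y, z)).
have cocoercive := subgrad_cocoercive dotE L_gt0 subgrad lip.
(* With the affine function of index [y] in place of the supremum, the objective at [y] becomes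
   [|y|^2 / 2 - p y + |x - f y|^2 / (2 L)], which is minimal at [x = f y]. *)
pose u y := y - L^-1 *: f y.
pose c y := `|f y| ^+ 2 / (2 * L) - p y.
pose quad (x : H) := (1 - L^-1) * (`|x| ^+ 2 / 2).
have GE : (fun x => affine_sup dot u c x - (quad x)%:E + (quad x)%:E)%E =
    affine_sup dot u c.
  by apply/funext => x; rewrite subeK.
have half_inv : (2 * L)^-1 = L^-1 / 2 by rewrite invfM mulrC.
exists (fun x => affine_sup dot u c x - (quad x)%:E)%E; split.
- move=> x; have := affine_sup_never_ninfty dot u c 0 x.
  by case: (affine_sup _ _ _ _).
- move=> y.
  have fyE : prox_objective (fun x => affine_sup dot u c x - (quad x)%:E)%E y
      (f y) = (`|y| ^+ 2 / 2 - p y)%:E.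
    rewrite /prox_objective (@affine_sup_attained _ _ _ _ _ _ y).
      rewrite -EFinB -EFinD; congr EFin.
      rewrite (sqr_normB dotE) /quad /c /u !dot_linear half_inv !(dotE (f y)).
      by field; rewrite gt_eqF.
    (* At the point [f y], cocoercivity says that no index [z] beats the index [y]. *)
    move=> z; have := cocoercive y z; rewrite (sqr_normB dotE) /u /c half_inv.
    rewrite !dot_linear (dotC dot z) (dotC dot y) -!dotE.
    by lra.
  split=> [|x]; rewrite fyE//.
  rewrite /prox_objective.
  apply: (@le_trans _ _
      ((2^-1 * `|y - x| ^+ 2)%:E + ((dot (u y) x + c y)%:E - (quad x)%:E))%E).
    rewrite -EFinB -EFinD lee_fin /u /c /quad half_inv.
    have : 0 <= L^-1 * `|x - f y| ^+ 2 by rewrite mulr_ge0 ?sqr_ge0// ltW.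
    by rewrite !(sqr_normB dotE) !dot_linear (dotC dot x); lra.
  by rewrite leeD2l// leeD2r// affine_sup_ge.
- by rewrite GE; exact: econvex_affine_sup.
- by rewrite GE; exact: lower_semicontinuous_affine_sup.
Qed.
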